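(* Let $\rho\ge 0$ and let $t=(\sqrt{1+8\rho}-1)/(2\rho)$ if $\rho>0$ and $t=2$ if $\rho=0$. In the two-dimensional Poisson regression model with interaction, the design $\xi_t$ which assigns equal weights $1/4$ to the four settings $\mathbf{x}_0=(0,0)$, $\mathbf{x}_1=(2,0)$, $\mathbf{x}_2=(0,2)$ and $\mathbf{x}_3=(t,t)$ is locally $D$-optimal at $\boldsymbol{\beta}=(0,-1,-1,-\rho)^\top$ on $\mathcal{X}=[0,\infty)^2$.
   Context: In the two-dimensional Poisson regression model with interaction, an observation $Y$ at setting $\mathbf{x}=(x_1,x_2)$ is Poisson distributed with mean $\lambda(\mathbf{x})=\exp(\mathbf{f}(\mathbf{x})^\top\boldsymbol{\beta})$, where $\mathbf{f}(\mathbf{x})=(1,x_1,x_2,x_1x_2)^\top$ and $\boldsymbol{\beta}=(\beta_0,\beta_1,\beta_2,\beta_{12})^\top$. An (approximate) design $\xi$ on $\mathcal{X}$ is a finite collection of mutually distinct settings $\mathbf{x}_0,\dots,\mathbf{x}_{n-1}\in\mathcal{X}$ with weights $w_i\ge 0$, $\sum_i w_i=1$; its information matrix is $\mathbf{M}_{\boldsymbol{\beta}}(\xi)=\sum_i w_i\lambda(\mathbf{x}_i)\mathbf{f}(\mathbf{x}_i)\mathbf{f}(\mathbf{x}_i)^\top$. A design is locally $D$-optimal at $\boldsymbol{\beta}$ on $\mathcal{X}$ if it maximizes $\det\mathbf{M}_{\boldsymbol{\beta}}(\xi)$ over all designs on $\mathcal{X}$. *)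

(* Defs.v *)
From HB Require Import structures.
From mathcomp Require Import all_boot all_order all_algebra.
From mathcomp Require Import all_classical all_reals all_analysis.
Set Implicit Arguments. Unset Strict Implicit. Unset Printing Implicit Defensive.
Import Order.TTheory GRing.Theory Num.Theory.
Local Open Scope ring_scope.

Section Poisson.
Variable R : realType.

Definition regf (x : R * R) : 'cV[R]_4 :=
  \col_(i < 4) nth 0 [:: 1; x.1; x.2; x.1 * x.2] i.

Definition intensity (beta : 'cV[R]_4) (x : R * R) : R :=
  expR (((regf x)^T *m beta) 0 0).

Definition is_design (X : set (R * R)) (xi : seq ((R * R) * R)) : Prop :=
  [/\ uniq (map fst xi),
      (forall p, p \in xi -> X p.1),
      (forall p, p \in xi -> 0 <= p.2)
    & \sum_(p <- xi) p.2 = 1].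

Definition info_mx (beta : 'cV[R]_4) (xi : seq ((R * R) * R)) : 'M[R]_4 :=
  \sum_(p <- xi) (p.2 * intensity beta p.1) *: (regf p.1 *m (regf p.1)^T).

Definition locally_D_optimal (beta : 'cV[R]_4) (X : set (R * R))
  (xi : seq ((R * R) * R)) : Prop :=
  is_design X xi /\
  forall eta, is_design X eta -> \det (info_mx beta eta) <= \det (info_mx beta xi).

Definition quadrant : set (R * R) := [set x | 0 <= x.1 /\ 0 <= x.2].

Definition beta_rho (rho : R) : 'cV[R]_4 :=
  \col_(i < 4) nth 0 [:: 0; -1; -1; - rho] i.

Definition t_rho (rho : R) : R :=
  if 0 < rho then (Num.sqrt (1 + 8 * rho) - 1) / (2 * rho) else 2.

Definition xi_t (t : R) : seq ((R * R) * R) :=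
  [:: ((0, 0), 1/4); ((2, 0), 1/4); ((0, 2), 1/4); ((t, t), 1/4)].

End Poisson.

(* Main.v *)
Require Import Defs.
From HB Require Import structures.
From mathcomp Require Import all_boot all_order all_algebra.
From mathcomp Require Import all_classical all_reals all_analysis.
From mathcomp Require Import ring lra.
Set Implicit Arguments. Unset Strict Implicit. Unset Printing Implicit Defensive.
Import Order.TTheory GRing.Theory Num.Theory.
Import numFieldNormedType.Exports.
Local Open Scope classical_set_scope.
Local Open Scope ring_scope.

(* The design is saturated, so its inverse information matrix is expressed by the
   Lagrange polynomials l_i of the support in the span of 1, x, y, xy. After
   normalizing by them, the information matrix of [xi_t] is I/4 and that of any
   other design is positive semidefinite with trace at most
   max_x sum_i (lambda(x) / lambda(x_i)) l_i(x)^2; by Hadamard and AM-GM its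
   determinant is at most (tr/4)^4, so it suffices to bound this maximum by 1.

   Since rho t^2 + t = 2, the sum of the l_i^2 / lambda(x_i) is, on a contour
   x + y + rho xy = c of the intensity, a convex quadratic in xy; hence only the
   endpoints of the contour matter, on the axes and on the diagonal. On the
   diagonal x = y = tu the bound is an equality at u = 0 and u = 1, and the
   derivative of the sensitivity function has the sign of (1 - u) times a quartic
   that changes sign only once on [0, oo), from negative to positive. The axis
   inequality is the square root of the diagonal one for t = 2. *)

(** * Positive semidefinite matrices *)

Definition psdmx (R : realType) (n : nat) (A : 'M[R]_n) : Prop :=
  A^T = A /\ forall v : 'rV_n, 0 <= (v *m A *m v^T) 0 0.

Lemma psdmx_diag_ge0 (R : realType) (n : nat) (A : 'M[R]_n) i : psdmx A -> 0 <= A i i.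
Proof.
case=> _ /(_ (delta_mx 0 i)).
by rewrite -rowE trmx_delta -colE !mxE.
Qed.

Lemma psdmx_congr (R : realType) (m n : nat) (B : 'M[R]_(m, n)) (A : 'M[R]_n) :
  psdmx A -> psdmx (B *m A *m B^T).
Proof.
move=> [symA posA]; split; first by rewrite !trmx_mul trmxK symA mulmxA.
by move=> v; have := posA (v *m B); rewrite trmx_mul !mulmxA.
Qed.

Lemma psdmx_sum_outer (R : realType) (n : nat) (I : eqType) (s : seq I) (w : I -> R)
    (f : I -> 'cV[R]_n) :
  (forall i, i \in s -> 0 <= w i) ->
  psdmx (\sum_(i <- s) w i *: (f i *m (f i)^T)).
Proof.
move=> w0; split.
  rewrite raddf_sum; apply: eq_bigr => i _ /=.
  by rewrite linearZ /= trmx_mul trmxK.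
move=> v; rewrite mulmx_sumr mulmx_suml summxE big_seq; apply: sumr_ge0 => i si.
rewrite -scalemxAr -scalemxAl mxE mulr_ge0 ?w0//.
have -> : v *m (f i *m (f i)^T) *m v^T = (v *m f i) *m (v *m f i)^T.
  by rewrite trmx_mul !mulmxA.
by rewrite [v *m f i]mx11_scalar tr_scalar_mx -scalar_mxM mxE eqxx mulr1n -expr2 sqr_ge0.
Qed.

(** Hadamard's inequality, by induction through the Schur complement [S] of the top left entry [a]:
    the determinant is [a * \det S], and the diagonal entries of [S] do not exceed the corresponding
    ones of [A]. *)
Lemma psdmx_det_bounds (R : realType) (n : nat) (A : 'M[R]_n) :
  psdmx A -> 0 <= \det A <= \prod_i A i i.
Proof.
elim: n A => [|n IH] A.
  by rewrite det_mx00 big_ord0 ler01 lexx.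
rewrite -[n.+1]/(1 + n)%N in A *.
move=> psdA; have [symA posA] := psdA.
pose a := A 0 0; pose b := ursubmx A; pose C := drsubmx A.
have aE : ulsubmx A = a%:M by rewrite [LHS]mx11_scalar !mxE; congr (A _ _)%:M; exact/val_inj.
have bT : dlsubmx A = b^T by rewrite -{1}symA -trmx_ursub.
have AE : A = block_mx a%:M b b^T C by rewrite -aE -bT submxK.
have a0 : 0 <= a by exact: psdmx_diag_ge0.
have quad s (v : 'rV_n) :
    0 <= s ^+ 2 * a + 2 * s * (b *m v^T) 0 0 + (v *m C *m v^T) 0 0.
  have := posA (row_mx s%:M v); rewrite AE mul_row_block tr_row_mx mul_row_col.
  have bvT : v *m b^T = ((b *m v^T) 0 0)%:M.
    by rewrite -tr_scalar_mx -mx11_scalar trmx_mul trmxK.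
  rewrite !mulmxDl bvT -[s%:M *m b *m _]mulmxA [b *m v^T]mx11_scalar.
  rewrite tr_scalar_mx -!scalar_mxM !mxE !eqxx !mulr1n.
  by move=> h; apply: (le_trans h); rewrite le_eqVlt; apply/orP; left; apply/eqP; ring.
have [a_0|an0] := eqVneq a 0.
  have b0 : b = 0.
    apply/rowP => i; rewrite [RHS]mxE.
    set k := C i i.
    have bi s : 0 <= 2 * s * b 0 i + k.
      have := quad s (delta_mx 0 i); rewrite a_0 mulr0 add0r trmx_delta -!colE -rowE.
      by rewrite [col i b 0 0]mxE [col i (row i C) 0 0]mxE [row i C 0 i]mxE.
    apply/eqP; apply: contraT => bi0.
    (* With a zero pivot the form is affine in [s]; this [s] would give it the value [-1]. *)
    have := bi (- (k + 1) / (2 * b 0 i)).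
    have -> : 2 * (- (k + 1) / (2 * b 0 i)) * b 0 i = - (k + 1) by field.
    by lra.
  have det0 : \det A = 0.
    rewrite AE a_0 b0 trmx0.
    by rewrite det_ublock det_scalar1 mul0r.
  by rewrite det0 lexx prodr_ge0// => i _; exact: psdmx_diag_ge0.
have {a0}agt0 : 0 < a by rewrite lt_neqAle eq_sym an0.
pose S := C - a^-1 *: (b^T *m b).
have symC : C^T = C by rewrite /C trmx_drsub symA.
have psdS : psdmx S.
  split.
    by rewrite /S linearB linearZ /= trmx_mul trmxK symC.
  (* This [s] minimizes the quadratic in [s], and the minimum is the form of [S] at [v]. *)
  move=> v; have := quad (- ((b *m v^T) 0 0) / a) v.
  move/le_trans; apply; rewrite le_eqVlt; apply/orP; left; apply/eqP.
  rewrite /S mulmxBr mulmxBl -scalemxAr -scalemxAl.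
  have -> : v *m (b^T *m b) *m v^T = (b *m v^T)^T *m (b *m v^T).
    by rewrite trmx_mul trmxK !mulmxA.
  rewrite [b *m v^T]mx11_scalar tr_scalar_mx -scalar_mxM !mxE eqxx !mulr1n.
  by field.
have detA : \det A = a * \det S.
  have /(congr1 determinant) : block_mx 1%:M 0 (- a^-1 *: b^T) 1%:M *m A = block_mx a%:M b 0 S.
    rewrite AE mulmx_block !mul1mx !mul0mx !addr0 -scalemxAl mul_mx_scalar.
    by rewrite scalerA mulNr mulVf// scaleN1r addNr -scalemxAl addrC scaleNr.
  by rewrite det_mulmx det_lblock !det1 !mul1r det_ublock det_scalar1.
have /andP[S0 Sle] : 0 <= \det S <= \prod_i S i i := IH _ psdS.
rewrite detA; apply/andP; split; first by rewrite mulr_ge0// ltW.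
rewrite big_split_ord/= big_ord1.
have -> : lshift n (0 : 'I_1) = 0 by exact/val_inj.
rewrite ler_wpM2l ?(ltW agt0)// (le_trans Sle)// ler_prod// => i _.
rewrite psdmx_diag_ge0//= /S !mxE big_ord1 !mxE lerBlDr lerDl.
by rewrite mulr_ge0 ?invr_ge0 ?(ltW agt0)// -expr2 sqr_ge0.
Qed.

Lemma psdmx_det_le_trace (R : realType) (n : nat) (A : 'M[R]_n) :
  psdmx A -> \det A <= (\tr A / n%:R) ^+ n.
Proof.
move=> psdA; have /andP[_ /le_trans] := psdmx_det_bounds psdA; apply.
have [AGM _] := @leif_AGM R 'I_n predT (fun i => A i i) (fun i _ => psdmx_diag_ge0 i psdA).
by move: AGM; rewrite cardT size_enum_ord.
Qed.

(** * The sensitivity function on the diagonal *)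

(* [sens_poly] at the diagonal point [(t u, t u)], for [a = e^2] and [b = e^(t+2)]. *)
Definition diag_poly (R : realType) (a b t u : R) : R :=
  (1 - u) ^+ 2 * ((1 - (t - 1) * u) ^+ 2 + a * t ^+ 2 / 2 * u ^+ 2) + b * u ^+ 4.

Definition quartic (R : realType) (h0 h1 h2 h3 h4 u : R) : R :=
  h0 + h1 * u + h2 * u ^+ 2 + h3 * u ^+ 3 + h4 * u ^+ 4.

(* With [E u = 2 t u + (2 - t) u^2], the derivative of [diag_poly / exp E] is
   [(1 - u) * diag_slope / exp E]. *)
Definition diag_slope (R : realType) (a b t u : R) : R :=
  let c := t - 1 in
  let d := a * t ^+ 2 / 2 in
  let g := c ^+ 2 + d in
  quartic (- 4 * t) (14 * c + 6 * c ^+ 2 + 2 * d)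
    (2 - 2 * c - 8 * c ^+ 2 - (6 + 2 * c) * g)
    (4 * (b + c * g - c + c ^+ 2)) (2 * (1 - c) * (b + g)) u.

Lemma expR2_ge3 (R : realType) : 3 <= expR 2 :> R.
Proof. by have := expR_ge1Dx (2 : R); lra. Qed.

Lemma expR2_le12 (R : realType) : expR 2 <= 12 :> R.
Proof.
(* The eighth power of this tangent bound gives [expR 2 <= (4 / 3) ^+ 8], which is below 10. *)
have e4 : 3 / 4 <= expR (- (1 / 4)) :> R by have := expR_ge1Dx (- (1 / 4) : R); lra.
have e2 : (3 / 4) ^+ 8 <= expR (- 2) :> R.
  have -> : (-2 : R) = 8%:R * (- (1 / 4)) by lra.
  by rewrite expRM_natl; apply: lerXn2r; rewrite ?nnegrE ?expR_ge0//; lra.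
have := expRxMexpNx_1 (2 : R); have := expR_gt0 (2 : R).
move: e2; set p := expR _; set q := expR _ => ? ? ?.
by nra.
Qed.

(** On the positive axis the quartic divided by [u ^+ 3] (first alternative) or by [u] (second
    alternative) is nondecreasing, so once positive it stays positive. *)
Lemma quartic_single_crossing (R : realType) (h0 h1 h2 h3 h4 u v : R) :
  h0 <= 0 -> 0 <= h3 -> 0 <= h4 ->
  (h1 <= 0 /\ h2 <= 0) \/ (0 <= h3 + h2 /\ 27 * h0 <= h2) ->
  0 < v -> v <= u -> quartic h0 h1 h2 h3 h4 u <= 0 -> quartic h0 h1 h2 h3 h4 v <= 0.
Proof.
rewrite /quartic => h0le h3ge h4ge h v0 vu Hu.
have u0 : 0 < u by lra.
case: h => [[h1le h2le]|[h32 h02]].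
- suff : u ^+ 3 * (h0 + h1 * v + h2 * v ^+ 2 + h3 * v ^+ 3 + h4 * v ^+ 4)
     <= v ^+ 3 * (h0 + h1 * u + h2 * u ^+ 2 + h3 * u ^+ 3 + h4 * u ^+ 4).
    move=> le3; have : u ^+ 3 * (h0 + h1 * v + h2 * v ^+ 2 + h3 * v ^+ 3 + h4 * v ^+ 4) <= 0.
      by apply: (le_trans le3); rewrite pmulr_rle0// exprn_gt0.
    by rewrite pmulr_rle0// exprn_gt0.
  rewrite -subr_ge0.
  have -> : v ^+ 3 * (h0 + h1 * u + h2 * u ^+ 2 + h3 * u ^+ 3 + h4 * u ^+ 4) -
     u ^+ 3 * (h0 + h1 * v + h2 * v ^+ 2 + h3 * v ^+ 3 + h4 * v ^+ 4) =
     (u - v) * (- h0 * (u ^+ 2 + u * v + v ^+ 2) + - h1 * (u * v * (u + v)) +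
       - h2 * (u ^+ 2 * v ^+ 2) + h4 * (u ^+ 3 * v ^+ 3)) by ring.
  apply: mulr_ge0; first by lra.
  by rewrite !addr_ge0// ?mulr_ge0// ?addr_ge0// ?mulr_ge0 ?exprn_ge0 ?oppr_ge0//; lra.
- suff : u * (h0 + h1 * v + h2 * v ^+ 2 + h3 * v ^+ 3 + h4 * v ^+ 4)
     <= v * (h0 + h1 * u + h2 * u ^+ 2 + h3 * u ^+ 3 + h4 * u ^+ 4).
    move=> le1; have : u * (h0 + h1 * v + h2 * v ^+ 2 + h3 * v ^+ 3 + h4 * v ^+ 4) <= 0.
      by apply: (le_trans le1); rewrite pmulr_rle0.
    by rewrite pmulr_rle0.
  rewrite -subr_ge0.
  have -> : v * (h0 + h1 * u + h2 * u ^+ 2 + h3 * u ^+ 3 + h4 * u ^+ 4) -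
     u * (h0 + h1 * v + h2 * v ^+ 2 + h3 * v ^+ 3 + h4 * v ^+ 4) =
     (u - v) * ((- h0 + u * v * (h2 + h3 * (u + v))) +
       h4 * (u * v * (u ^+ 2 + u * v + v ^+ 2))) by ring.
  apply: mulr_ge0; first by lra.
  apply: addr_ge0; last first.
    by rewrite mulr_ge0// ?mulr_ge0// ?addr_ge0// ?mulr_ge0 ?exprn_ge0 ?oppr_ge0//; lra.
  have uv0 : 0 < u * v by rewrite mulr_gt0.
  have [h2ge|h2lt] := leP 0 h2.
    by rewrite !addr_ge0// ?mulr_ge0// ?addr_ge0// ?mulr_ge0; lra.
  (* With [s = u + v], one has [u * v <= s ^+ 2 / 4], and [s ^+ 2 * (1 - s) / 4] has its maximum
     [1 / 27] on [s >= 0] at [s = 2 / 3]. *)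
  have uvs : 0 <= 1 / 27 + u * v * ((u + v) - 1).
    have [s1|s1] := leP 1 (u + v).
      by rewrite addr_ge0// ?mulr_ge0//; lra.
    have : u * v * (1 - (u + v)) <= (u + v) ^+ 2 / 4 * (1 - (u + v)).
      by apply: ler_wpM2r; [lra|have := sqr_ge0 (u - v); nra].
    have : 0 <= (u + v - 2 / 3) ^+ 2 * (u + v + 1 / 3).
      by rewrite mulr_ge0 ?sqr_ge0//; lra.
    by nra.
  have h3uv : - h2 * (u * v * (u + v)) <= h3 * (u * v * (u + v)).
    by apply: ler_wpM2r; [rewrite !mulr_ge0//; lra|lra].
  have : 0 <= - h2 * (1 / 27 + u * v * ((u + v) - 1)) by rewrite mulr_ge0//; lra.
  by nra.
Qed.

(** Crude bounds on the exponentials [a] and [b] already fix the signs of the coefficients: the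
    first alternative of [quartic_single_crossing] holds for [t <= 1 / 2], the second for larger
    [t]. *)
Lemma diag_slope_single_crossing (R : realType) (a b t u v : R) :
  3 <= a <= 12 -> a * (1 + t) <= b -> 0 <= t <= 2 ->
  0 < v -> v <= u -> diag_slope a b t u <= 0 -> diag_slope a b t v <= 0.
Proof.
move=> /andP[a3 a12] hb /andP[t0 t2].
have t2_0 : 0 <= t ^+ 2 by rewrite sqr_ge0.
have t2_2t : t ^+ 2 <= 2 * t by rewrite expr2 ler_wpM2r.
have t3_0 : 0 <= t ^+ 3 by rewrite exprn_ge0.
have at2_12 : a * t ^+ 2 <= 12 * t ^+ 2 by rewrite ler_wpM2r.
have at2_3 : 3 * t ^+ 2 <= a * t ^+ 2 by rewrite ler_wpM2r.
apply: quartic_single_crossing.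
- by lra.
- have : 3 * (1 + (t - t ^+ 2 / 2) + t ^+ 3 / 2) <= a * (1 + (t - t ^+ 2 / 2) + t ^+ 3 / 2).
    by rewrite ler_wpM2r//; lra.
  have : 0 <= t * (t - 1) ^+ 2 by rewrite mulr_ge0 ?sqr_ge0.
  by nra.
- have : 0 <= (2 - t) * (b + ((t - 1) ^+ 2 + a * t ^+ 2 / 2)).
    rewrite mulr_ge0//; first by lra.
    have : 0 <= a * (1 + t) by rewrite mulr_ge0//; lra.
    by have := sqr_ge0 (t - 1); lra.
  by nra.
have [tle|tge] := leP t (1 / 2); [left|right]; split.
- have : 0 <= t * (1 / 2 - t) by rewrite mulr_ge0//; lra.
  by nra.
- have : 0 <= (4 + 2 * t) * (a * t ^+ 2) by rewrite mulr_ge0//; lra.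
  have : 0 <= t * (1 / 2 - t) by rewrite mulr_ge0//; lra.
  have : 0 <= t * (1 / 2 - t) ^+ 2 by rewrite mulr_ge0 ?sqr_ge0.
  by nra.
- have : 3 * (4 + t * (2 - t) ^+ 2) <= a * (4 + t * (2 - t) ^+ 2).
    by rewrite ler_wpM2r// addr_ge0// mulr_ge0 ?sqr_ge0.
  have : 0 <= t * (2 - t) by rewrite mulr_ge0//; lra.
  have : 0 <= t * (2 - t) ^+ 2 by rewrite mulr_ge0 ?sqr_ge0.
  have : 0 <= t ^+ 2 * (2 - t) by rewrite mulr_ge0//; lra.
  by nra.
- have : (4 + 2 * t) * (a * t ^+ 2) <= (4 + 2 * t) * (12 * t ^+ 2).
    by rewrite ler_wpM2l//; lra.
  have : 0 <= (t - 1 / 2) * (2 - t) by rewrite mulr_ge0//; lra.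
  have : 0 <= t * ((t - 1 / 2) * (2 - t)) by rewrite mulr_ge0// mulr_ge0//; lra.
  by nra.
Qed.

(** This places the sign change of [diag_slope] before [u = 1], where the other factor [1 - u] of
    the derivative changes sign. *)
Lemma diag_slope1_gt0 (R : realType) (a b t : R) :
  3 <= a <= 12 -> a * (1 + t) <= b -> 0 <= t <= 2 -> 0 < diag_slope a b t 1.
Proof.
move=> /andP[a3 a12] hb /andP[t0 t2]; rewrite /diag_slope /quartic.
have : 0 <= (4 - t) * (b - a * (1 + t)) by rewrite mulr_ge0//; lra.
have : 3 * (2 * (4 + 3 * t - t ^+ 2) - t ^+ 2) <= a * (2 * (4 + 3 * t - t ^+ 2) - t ^+ 2).
  by rewrite ler_wpM2r//; nra.
by nra.
Qed.

Lemma is_derive_diag (R : realType) (a b t u : R) :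
  is_derive u 1 (fun v : R => expR (- (2 * t * v + (2 - t) * v ^+ 2)) * diag_poly a b t v)
    (expR (- (2 * t * u + (2 - t) * u ^+ 2)) * ((1 - u) * diag_slope a b t u)).
Proof.
rewrite /diag_poly.
apply: is_derive_eq.
rewrite /diag_slope /quartic /GRing.scale /=.
by ring.
Qed.

(** The ratio [f] of the two sides falls from [f 0 = 1] until [diag_slope] changes sign, rises to
    [f 1 = 1], and falls again beyond 1. *)
Lemma diag_bound (R : realType) (t u : R) : 0 <= t <= 2 -> 0 <= u ->
  diag_poly (expR 2) (expR (t + 2)) t u <= expR (2 * t * u + (2 - t) * u ^+ 2).
Proof.
set a := expR 2; set b := expR (t + 2) => t02 u0.
have a312 : 3 <= a <= 12 by rewrite expR2_ge3 expR2_le12.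
have ab : a * (1 + t) <= b.
  by rewrite /b (addrC t) expRD ler_wpM2l ?expR_ge0// expR_ge1Dx.
pose f (v : R) := expR (- (2 * t * v + (2 - t) * v ^+ 2)) * diag_poly a b t v.
have df x : derivable f x 1 by exact: (is_derive_diag a b t x).(ex_derive).
have f'E x : derive1 f x = expR (- (2 * t * x + (2 - t) * x ^+ 2)) * ((1 - x) * diag_slope a b t x).
  by rewrite derive1E; exact: (is_derive_diag a b t x).(derive_val).
have cf (x y : R) : {within `[x, y], continuous f}.
  by apply: derivable_within_continuous.
have f0 : f 0 = 1.
  by rewrite /f /diag_poly !(mulr0, expr0n, addr0, oppr0, expR0, subr0, expr1n, mulr1)/=.
have f1 : f 1 = 1.
  rewrite /f /diag_poly subrr expr0n mul0r add0r !expr1n !mulr1 /b -expRD -[RHS]expR0.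
  by congr expR; ring.
have cross := @diag_slope_single_crossing _ a b t _ _ a312 ab t02.
suff : f u <= 1.
  rewrite /f expRN mulrC ler_pdivrMr ?expR_gt0//.
  by rewrite mul1r.
have ge0_after v x : 0 < v -> v <= x -> 0 < diag_slope a b t v -> 0 <= diag_slope a b t x.
  move=> v0 vx; apply: contraTT; rewrite -ltNge -leNgt => /ltW.
  exact: cross.
have [u1|u1] := leP u 1; last first.
  rewrite -f1; apply: (@ler0_derive1_le_cc _ f 1 u) => //; rewrite ?in_itv/= ?lexx ?(ltW u1)//.
  move=> x; rewrite in_itv/= => /andP[x1 xu]; rewrite f'E pmulr_rle0 ?expR_gt0//.
  by rewrite nmulr_rle0 ?subr_lt0// (ge0_after 1) ?diag_slope1_gt0// ltW.
have [Hu|Hu] := leP (diag_slope a b t u) 0.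
  rewrite -f0; apply: (@ler0_derive1_le_cc _ f 0 u) => //; rewrite ?in_itv/= ?lexx ?u0//.
  move=> x; rewrite in_itv/= => /andP[x0 xu]; rewrite f'E pmulr_rle0 ?expR_gt0//.
  by rewrite pmulr_rle0 ?subr_gt0 ?(lt_le_trans xu)// (cross _ _ _ (ltW xu)).
have {}u0 : 0 < u.
  rewrite lt_neqAle u0 andbT; apply/eqP => u0'; move: Hu.
  rewrite -u0' /diag_slope /quartic !expr0n/= !mulr0 !addr0.
  by case/andP: t02 => ? ? ?; lra.
rewrite -f1; apply: (@ger0_derive1_le_cc _ f u 1) => //; rewrite ?in_itv/= ?lexx ?u1//.
move=> x; rewrite in_itv/= => /andP[ux x1]; rewrite f'E pmulr_rge0 ?expR_gt0//.
by rewrite pmulr_rge0 ?subr_gt0// (ge0_after u)// ltW.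
Qed.

(** The value [t = 2] belongs to [rho = 0], where the model is a product of two one-dimensional
    ones; its sensitivity on the diagonal is therefore the square of the one on an axis. *)
Lemma axis_bound (R : realType) (x : R) : 0 <= x ->
  (1 - x / 2) ^+ 2 + expR 2 * x ^+ 2 / 4 <= expR x.
Proof.
move=> x0; have := @diag_bound R 2 (x / 2).
rewrite lexx ler0n divr_ge0// => /(_ isT isT).
have -> : 2 * 2 * (x / 2) + (2 - 2) * (x / 2) ^+ 2 = 2%:R * x by field.
have -> : diag_poly (expR 2) (expR (2 + 2)) 2 (x / 2) =
    ((1 - x / 2) ^+ 2 + expR 2 * x ^+ 2 / 4) ^+ 2.
  by rewrite /diag_poly (expRD 2 2); field.
rewrite expRM_natl ler_pXn2r// nnegrE ?expR_ge0// addr_ge0 ?sqr_ge0//.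
by rewrite divr_ge0// mulr_ge0 ?expR_ge0 ?sqr_ge0.
Qed.

(** * Reduction to the axes and the diagonal *)

(* The sensitivity function divided by four times the intensity, in the
   coordinates [s = x + y], [p = x * y]. *)
Definition sens_poly (R : realType) (t s p : R) : R :=
  (1 - s / 2 + (t - 1) / t ^+ 2 * p) ^+ 2
  + expR 2 / (4 * t ^+ 2) * (t ^+ 2 * (s ^+ 2 - 2 * p) - 2 * t * p * s + 2 * p ^+ 2)
  + expR (t + 2) / t ^+ 4 * p ^+ 2.

Lemma sens_poly_le (R : realType) (t rho x y : R) :
  0 < t <= 2 -> 0 <= rho -> rho * t ^+ 2 + t = 2 -> 0 <= x -> 0 <= y ->
  sens_poly t (x + y) (x * y) <= expR (x + y + rho * (x * y)).
Proof.
move=> /andP[t0 t2] rho0 rhot x0 y0.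
have tn0 : t != 0 by rewrite gt_eqF.
have rhoE : rho = (2 - t) / t ^+ 2 by rewrite -rhot addrK mulfK// expf_neq0.
have p0 : 0 <= x * y by rewrite mulr_ge0.
set p := x * y in p0 *; set c := x + y + rho * p.
have c0 : 0 <= c by rewrite /c !addr_ge0// mulr_ge0.
have axis : sens_poly t c 0 <= expR c.
  apply: le_trans (axis_bound c0); rewrite /sens_poly le_eqVlt; apply/orP; left; apply/eqP.
  by field.
(* The diagonal point [(z, z)] has the same intensity as [(x, y)]. *)
pose q := Num.sqrt (1 + rho * c).
have q0 : 0 <= q by rewrite sqrtr_ge0.
have q2 : q ^+ 2 = 1 + rho * c by rewrite sqr_sqrtr// addr_ge0// mulr_ge0.
(* The nonnegative root of [rho * z ^+ 2 + 2 * z = c], rationalized so that it also covers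
   [rho = 0]. *)
pose z := c / (1 + q).
have z0 : 0 <= z by rewrite divr_ge0// addr_ge0.
have zE : 2 * z + rho * z ^+ 2 = c.
  have q1 : 1 + q != 0 by rewrite gt_eqF// ltr_pwDl.
  apply: (mulfI (expf_neq0 2 q1)); apply/eqP; rewrite -subr_eq0; apply/eqP.
  transitivity (c * (1 + rho * c - q ^+ 2)); first by rewrite /z; field.
  by rewrite q2 subrr mulr0.
have diag : sens_poly t (2 * z) (z ^+ 2) <= expR c.
  have := @diag_bound R t (z / t); rewrite (ltW t0) t2 divr_ge0 ?(ltW t0)// => /(_ isT isT).
  rewrite (_ : 2 * t * (z / t) + (2 - t) * (z / t) ^+ 2 = c); last first.
    by rewrite -zE rhoE; field.
  apply: le_trans; rewrite le_eqVlt; apply/orP; left; apply/eqP.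
  by rewrite /sens_poly /diag_poly; field.
(* If [x + y <= 2 * z] this is AM-GM; otherwise [p > z ^+ 2] would make the exponent at [(x, y)]
   exceed [c]. *)
have pz : p <= z ^+ 2.
  have [xyz|xyz] := leP (x + y) (2 * z).
    by have := sqr_ge0 (x - y); rewrite /p; nra.
  rewrite leNgt; apply/negP => zp.
  have : rho * z ^+ 2 <= rho * p by rewrite ler_wpM2l// ltW.
  by move: zE; rewrite /c; lra.
have sE : x + y = c - rho * p by rewrite /c addrK.
have zcE : 2 * z = c - rho * z ^+ 2 by rewrite -zE addrK.
(* Along a contour of the intensity, [sens_poly] is a convex quadratic in [p]. *)
have convex : z ^+ 2 * sens_poly t (x + y) p <=
    (z ^+ 2 - p) * sens_poly t c 0 + p * sens_poly t (2 * z) (z ^+ 2).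
  rewrite -subr_ge0 sE zcE; set m := z ^+ 2.
  (* The coefficient of [p ^+ 2] along the contour; the gap between the chord over [[0, m]] and the
     quadratic is [lead * p * (m - p)]. *)
  pose lead := (rho / 2 + (t - 1) / t ^+ 2) ^+ 2
    + expR 2 / (4 * t ^+ 2) * ((t * rho + 1) ^+ 2 + 1) + expR (t + 2) / t ^+ 4.
  have -> : (m - p) * sens_poly t c 0 + p * sens_poly t (c - rho * m) m -
      m * sens_poly t (c - rho * p) p = lead * (m * p * (m - p)).
    by rewrite /sens_poly /lead; field.
  apply: mulr_ge0; last by rewrite mulr_ge0 ?subr_ge0// mulr_ge0// sqr_ge0.
  have inv0 n : 0 <= (t ^+ n)^-1 by rewrite invr_ge0 exprn_ge0// ltW.
  rewrite /lead addr_ge0 ?addr_ge0 ?sqr_ge0// ?mulr_ge0 ?expR_ge0 ?inv0//.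
    by rewrite invr_ge0 mulr_ge0// sqr_ge0.
  by rewrite addr_ge0 ?sqr_ge0.
have [zgt0|z_0] := ltP 0 z.
  rewrite -(@ler_pM2l _ (z ^+ 2)) ?exprn_gt0//; apply: (le_trans convex).
  rewrite -[leRHS](_ : (z ^+ 2 - p) * expR c + p * expR c = _); last by ring.
  by rewrite lerD// ler_wpM2l// subr_ge0.
(* For [z = 0] the chord degenerates to a point, and the axis bound is the claim. *)
have p_0 : p = 0 by apply/eqP; rewrite eq_le p0 andbT (le_trans pz)//; nra.
by rewrite sE p_0 mulr0 subr0.
Qed.

(** * Optimality *)

(** Congruence by [K] multiplies every determinant by the same [\det K ^+ 2], nonzero because the
    normalized matrix of [xi] is invertible. For any other design the normalized trace is a weighted
    mean of quantities at most 1. *)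
Lemma locally_D_optimal_normalized (R : realType) (beta : 'cV[R]_4) (X : set (R * R))
    (xi : seq ((R * R) * R)) (K : 'M[R]_4) :
  is_design X xi -> K *m info_mx beta xi *m K^T = (1 / 4)%:M ->
  (forall x, X x -> intensity beta x * \tr ((K *m regf x) *m (K *m regf x)^T) <= 1) ->
  locally_D_optimal beta X xi.
Proof.
move=> dxi Kxi sens; split=> // eta [_ Xeta w0 w1].
have : psdmx (K *m info_mx beta eta *m K^T).
  apply: psdmx_congr; apply: psdmx_sum_outer => p /w0 p0.
  by rewrite mulr_ge0// expR_ge0.
set N := _ *m K^T => psdN.
have trN : \tr N <= 1.
  rewrite /N /info_mx mulmx_sumr mulmx_suml raddf_sum -w1 /= !big_seq.
  apply: ler_sum => p pin; rewrite -scalemxAr -scalemxAl mxtraceZ -mulrA.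
  rewrite -[leRHS]mulr1 ler_wpM2l ?w0//.
  by have := sens _ (Xeta _ pin); rewrite trmx_mul !mulmxA.
have trN0 : 0 <= \tr N by apply: sumr_ge0 => i _; exact: psdmx_diag_ge0.
have detN : \det N <= (1 / 4) ^+ 4.
  apply: le_trans (psdmx_det_le_trace psdN) _.
  by rewrite lerXn2r ?nnegrE ?divr_ge0// ler_wpM2r// invr_ge0.
have detK : \det K ^+ 2 * \det (info_mx beta xi) = (1 / 4) ^+ 4.
  by have := congr1 determinant Kxi; rewrite !det_mulmx det_tr det_scalar => <-; ring.
have K0 : 0 < \det K ^+ 2.
  rewrite lt_neqAle sqr_ge0 andbT eq_sym; apply: contra_eq_neq detK => ->.
  by rewrite mul0r eq_sym expf_neq0//; lra.
rewrite -(ler_pM2l K0) detK; apply: le_trans detN.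
by rewrite /N !det_mulmx det_tr le_eqVlt; apply/orP; left; apply/eqP; ring.
Qed.

Lemma intensity_beta_rho (R : realType) (rho : R) (x : R * R) :
  intensity (beta_rho rho) x = expR (- (x.1 + x.2 + rho * (x.1 * x.2))).
Proof.
rewrite /intensity mxE !big_ord_recl big_ord0 !mxE /=; congr expR; ring.
Qed.

(* The rows hold the coefficients, in the basis [1, x, y, xy], of the Lagrange
   polynomials of the support of [xi_t t], each divided by the square root of
   the intensity at its node. *)
Definition scaled_lagrange (R : realType) (t : R) : 'M[R]_4 :=
  let e := expR 1 in
  \matrix_(i, j) nth 0 (nth [::]
    [:: [:: 1; - (1 / 2); - (1 / 2); (t - 1) / t ^+ 2];
        [:: 0; e / 2; 0; - e / (2 * t)];
        [:: 0; 0; e / 2; - e / (2 * t)];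
        [:: 0; 0; 0; expR (t / 2 + 1) / t ^+ 2]] i) j.

Lemma scaled_lagrange_regf (R : realType) (t x y : R) :
  scaled_lagrange t *m regf (x, y) =
  \col_i nth 0 [:: 1 - (x + y) / 2 + (t - 1) / t ^+ 2 * (x * y);
    expR 1 / 2 * x - expR 1 / (2 * t) * (x * y);
    expR 1 / 2 * y - expR 1 / (2 * t) * (x * y);
    expR (t / 2 + 1) / t ^+ 2 * (x * y)] i.
Proof.
apply/colP => i; rewrite !mxE !big_ord_recl big_ord0 !mxE /=.
by case: i => [[|[|[|[|//]]]] ?] /=; ring.
Qed.

Lemma t_rho_itv (R : realType) (rho : R) : 0 <= rho -> 0 < t_rho rho <= 2.
Proof.
rewrite /t_rho le_eqVlt => /predU1P[<-|rho0]; first by rewrite ltxx ltr0n lexx.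
rewrite rho0; set s := Num.sqrt _.
have s0 : 0 <= s by rewrite sqrtr_ge0.
have s2 : s ^+ 2 = 1 + 8 * rho by rewrite sqr_sqrtr//; lra.
rewrite divr_gt0 ?ler_pdivrMr ?mulr_gt0//; by nra.
Qed.

(** This equation makes [(t, t)] a stationary point of the sensitivity along the diagonal, and it
    turns the intensity there into [expR (- (t + 2))]. *)
Lemma t_rhoP (R : realType) (rho : R) : 0 <= rho ->
  rho * t_rho rho ^+ 2 + t_rho rho = 2.
Proof.
rewrite /t_rho le_eqVlt => /predU1P[<-|rho0]; first by rewrite ltxx; ring.
rewrite rho0; set s := Num.sqrt _.
have s2 : s ^+ 2 = 1 + 8 * rho by rewrite sqr_sqrtr//; lra.
have -> : rho * ((s - 1) / (2 * rho)) ^+ 2 + (s - 1) / (2 * rho) = (s ^+ 2 - 1) / (4 * rho).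
  by field; rewrite gt_eqF.
by rewrite s2; field; rewrite gt_eqF.
Qed.

Theorem theorem2 (R : realType) (rho : R) (hrho : 0 <= rho) :
  locally_D_optimal (beta_rho rho) (@quadrant R) (xi_t (t_rho rho)).
Proof.
have := t_rhoP hrho; have := t_rho_itv hrho; move: (t_rho rho) => t t02 rhot.
have /andP[t0 t2] := t02.
have tn0 : t != 0 by rewrite gt_eqF.
(* The rows of [scaled_lagrange] carry square roots of inverse intensities, whose squares enter
   [sens_poly]. *)
have e1E : expR 1 ^+ 2 = expR 2 :> R by rewrite -expRM_natl mulr1.
have e3E : expR (t / 2 + 1) ^+ 2 = expR (t + 2) :> R.
  by rewrite -expRM_natl; congr expR; field.
apply: (@locally_D_optimal_normalized _ _ _ _ (scaled_lagrange t)).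
- split.
  + rewrite /= !inE !negb_or !xpair_eqE !eqxx /= !andbT ?andbF ?(eq_sym 0).
    by rewrite !pnatr_eq0 /= !(negPf tn0) /= andbF.
  + move=> p; rewrite !inE => /or4P[] /eqP -> /=; split=> //=; exact: ltW.
  + by move=> p; rewrite !inE => /or4P[] /eqP -> /=; lra.
  + by rewrite !big_cons big_nil /=; lra.
- rewrite /info_mx /xi_t !big_cons big_nil addr0 /= !intensity_beta_rho /=.
  rewrite !mulmxDr !mulmxDl -!scalemxAr -!scalemxAl.
  have outer (x : R * R) : scaled_lagrange t *m (regf x *m (regf x)^T) *m (scaled_lagrange t)^T
      = (scaled_lagrange t *m regf x) *m (scaled_lagrange t *m regf x)^T.
    by rewrite trmx_mul !mulmxA.
  rewrite !outer !scaled_lagrange_regf.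
  rewrite (_ : - (0 + 0 + rho * (0 * 0)) = 0 ); last by ring.
  rewrite (_ : - (2 + 0 + rho * (2 * 0)) = - 2 ); last by ring.
  rewrite (_ : - (0 + 2 + rho * (0 * 2)) = - 2 ); last by ring.
  rewrite (_ : - (t + t + rho * (t * t)) = - (t + 2)); last by rewrite -rhot; ring.
  rewrite !expRN expR0 -e1E -e3E.
  have := expR_gt0 (1 : R); have := expR_gt0 (t / 2 + 1).
  move: (expR 1) (expR (t / 2 + 1)) => e e3 /gt_eqF/negbT e30 /gt_eqF/negbT e0.
  apply/matrixP => i j; rewrite !mxE !big_ord1 !mxE /=.
  by case: i => [[|[|[|[|//]]]] ?]; case: j => [[|[|[|[|//]]]] ?] /=;
    rewrite ?mulr1n ?mulr0n; field; rewrite ?e0 ?e30 ?tn0.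
move=> [x y] [/= x0 y0]; rewrite intensity_beta_rho /= expRN mulrC ler_pdivrMr ?expR_gt0// mul1r.
apply: le_trans (sens_poly_le t02 hrho rhot x0 y0).
rewrite /mxtrace !big_ord_recl big_ord0 scaled_lagrange_regf.
rewrite !mxE !big_ord1 !mxE /= /sens_poly -e1E -e3E le_eqVlt; apply/orP; left; apply/eqP.
by field.
Qed.
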